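(* Let $(E,e,\mathbb{F})$ be a conditional Riesz triple. Then the following hold. (i) $M_{\mathbb{F}}$ and $m_{\mathbb{F}}$ are idempotent and increasing operators from $\mathcal{L}^{\infty}(\mathbb{F})$ to $R(\mathbb{F})$. (ii) $M_{\mathbb{F}}$ is positively homogeneous and sub-additive: for all $\lambda\in\mathbb{R}_{+}$ and $f,g\in\mathcal{L}^{\infty}(\mathbb{F})$, $$M_{\mathbb{F}}(\lambda f)=\lambda M_{\mathbb{F}}(f)\quad\text{and}\quad M_{\mathbb{F}}(f+g)\leq M_{\mathbb{F}}(f)+M_{\mathbb{F}}(g).$$ If, in addition, $g\in R(\mathbb{F})$, then $$M_{\mathbb{F}}(f+g)=g+M_{\mathbb{F}}(f)\quad\text{and}\quad m_{\mathbb{F}}(f+g)=g+m_{\mathbb{F}}(f).$$ (iii) For all $f,g\in\mathcal{L}^{\infty}(\mathbb{F})$, $$|M_{\mathbb{F}}(f)-M_{\mathbb{F}}(g)|\leq M_{\mathbb{F}}(|f-g|)\quad\text{and}\quad |m_{\mathbb{F}}(f)-m_{\mathbb{F}}(g)|\leq M_{\mathbb{F}}(|f-g|).$$ In particular, $|M_{\mathbb{F}}(f)|\leq M_{\mathbb{F}}(|f|)$.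
   Context: A conditional Riesz triple $(E,e,\mathbb{F})$ consists of a Dedekind complete Riesz space $E$, a weak order unit $e$ of $E$, and a conditional expectation operator $\mathbb{F}$ on $E$, i.e. a strictly positive order continuous linear projection with $\mathbb{F}e=e$ whose range is a Dedekind complete Riesz subspace. $E^{u}$ is the universal completion of $E$, an $f$-algebra with unit $e$. $\mathbb{F}$ extends uniquely to a conditional expectation, still denoted $\mathbb{F}$, on its natural domain $\mathcal{L}^{1}(\mathbb{F})$, the largest Riesz subspace of $E^{u}$ to which $\mathbb{F}$ so extends (its positive elements are those $z\in E^{u}_{+}$ for which there is a net $0\le x_\alpha\uparrow z$ in $E$ with $(\mathbb{F}x_\alpha)$ order bounded in $E^{u}$, and then $\mathbb{F}z=\sup_\alpha\mathbb{F}x_\alpha$). $R(\mathbb{F})$ denotes the range of this extension. $\mathcal{L}^{\infty}(\mathbb{F})$ is the ideal of $E^{u}$ generated by $R(\mathbb{F})$, i.e. the set of $f$ with $|f|\leq u$ for some $u\in R(\mathbb{F})$. For $f\in\mathcal{L}^{\infty}(\mathbb{F})$, the conditional supremum and infimum are $$M_{\mathbb{F}}(f)=\inf\{g\in R(\mathbb{F}): f\leq g\},\qquad m_{\mathbb{F}}(f)=\sup\{g\in R(\mathbb{F}): g\leq f\}.$$ *)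

(* Defs.v *)
From HB Require Import structures.
From mathcomp Require Import all_boot all_order all_algebra.
From mathcomp Require Import boolp classical_sets reals.

Set Implicit Arguments.
Unset Strict Implicit.
Unset Printing Implicit Defensive.

Import Order.TTheory GRing.Theory Num.Theory.
Local Open Scope classical_set_scope.
Local Open Scope ring_scope.

(* A Riesz space over R: a real vector space with a lattice order that is
   compatible with the linear structure.  Lattice.type cannot be a parent here,
   as the hierarchy has no join of lattices and Z-modules below realDomainType;
   the meet and join are therefore fields, and every rieszType is then made a
   latticeType, so that Order.join, Order.meet and their theory apply. *)
HB.mixin Record POrderedLmodule_isRiesz (R : realType) E
    of GRing.Lmodule R E & Num.POrderedZmodule E := {
  riesz_meet : E -> E -> E;
  riesz_join : E -> E -> E;
  riesz_lexI : forall x y z : E,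
    (x <= riesz_meet y z) = (x <= y) && (x <= z);
  riesz_leUx : forall x y z : E,
    (riesz_join x y <= z) = (x <= z) && (y <= z);
  riesz_lerD2r : forall x y z : E, x <= y -> x + z <= y + z;
  riesz_scaler_ge0 : forall (a : R) (x : E), 0 <= a -> 0 <= x -> 0 <= a *: x
}.

#[short(type="rieszType")]
HB.structure Definition Riesz (R : realType) :=
  { E of GRing.Lmodule R E & Num.POrderedZmodule E
       & POrderedLmodule_isRiesz R E }.

HB.instance Definition _ (R : realType) (E : rieszType R) :=
  Order.POrder_MeetJoin_isLattice.Build ring_display E
    (@riesz_lexI R E) (@riesz_leUx R E).

Definition vpos {R : realType} {E : rieszType R} (x : E) : E := Order.join x 0.
Definition vneg {R : realType} {E : rieszType R} (x : E) : E :=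
  Order.join (- x) 0.
Definition vabs {R : realType} {E : rieszType R} (x : E) : E :=
  Order.join x (- x).

Definition dedekind_complete {R : realType} (E : rieszType R) : Prop :=
  forall A : set E, has_sup A -> supremums A !=set0.

Definition riesz_subspace {R : realType} {E : rieszType R} (S : set E) : Prop :=
  [/\ S 0,
      forall x y, S x -> S y -> S (x + y),
      forall (a : R) x, S x -> S (a *: x),
      forall x y, S x -> S y -> S (Order.join x y) &
      forall x y, S x -> S y -> S (Order.meet x y)].

(* Bounds and suprema are relative to S. *)
Definition dedekind_complete_subspace {R : realType} {E : rieszType R}
    (S : set E) : Prop :=
  forall A : set E, A `<=` S -> A !=set0 -> S `&` ubound A !=set0 ->
  exists s, [/\ S s, ubound A s & forall t, S t -> ubound A t -> s <= t].

Definition weak_order_unit {R : realType} {E : rieszType R} (e : E) : Prop :=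
  0 <= e /\ forall x : E, Order.meet e (vabs x) = 0 -> x = 0.

Definition directed {I : Type} (r : I -> I -> Prop) : Prop :=
  [/\ inhabited I, forall i, r i i, forall i j k, r i j -> r j k -> r i k &
      forall i j, exists k, r i k /\ r j k].

Definition net_increases_to {R : realType} {E : rieszType R} {I : Type}
    (r : I -> I -> Prop) (x : I -> E) (z : E) : Prop :=
  (forall i j, r i j -> x i <= x j) /\ supremums (range x) z.

Definition net_decreases_to {R : realType} {E : rieszType R} {I : Type}
    (r : I -> I -> Prop) (x : I -> E) (z : E) : Prop :=
  (forall i j, r i j -> x j <= x i) /\ infimums (range x) z.

Definition order_converges {R : realType} {E : rieszType R} {I : Type}
    (r : I -> I -> Prop) (x : I -> E) (z : E) : Prop :=
  exists y : I -> E, net_decreases_to r y 0 /\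
    forall i, vabs (x i - z) <= y i.

Definition order_continuous {R : realType} {E E' : rieszType R}
    (T : E -> E') : Prop :=
  forall (I : Type) (r : I -> I -> Prop) (x : I -> E) (z : E), directed r ->
  order_converges r x z -> order_converges r (T \o x) (T z).

Definition order_bounded {R : realType} {E : rieszType R} (A : set E) : Prop :=
  exists a b : E, forall x, A x -> a <= x <= b.

Record conditional_expectation {R : realType} {E : rieszType R} (e : E)
    (F : {linear E -> E}) : Prop := ConditionalExpectation {
  ce_strictly_positive : forall x : E, 0 < x -> 0 < F x;
  ce_order_continuous : order_continuous F;
  ce_projection : forall x, F (F x) = F x;
  ce_unit : F e = e;
  ce_range_subspace : riesz_subspace (range F);
  ce_range_complete : dedekind_complete_subspace (range F)
}.

Record conditional_riesz_triple {R : realType} (E : rieszType R) (e : E)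
    (F : {linear E -> E}) : Prop := ConditionalRieszTriple {
  crt_complete : dedekind_complete E;
  crt_unit : weak_order_unit e;
  crt_condexp : conditional_expectation e F
}.

(* Nonemptiness is needed: the empty set has no supremum unless E is zero. *)
Definition laterally_complete {R : realType} (E : rieszType R) : Prop :=
  forall A : set E, A !=set0 -> (forall x, A x -> 0 <= x) ->
  (forall x y, A x -> A y -> x <> y -> Order.meet x y = 0) ->
  supremums A !=set0.

(* (Eu, iota) is a universal completion of E: a universally complete Riesz
   space containing E, via iota, as an order dense Riesz subspace.  It is
   determined by E up to a unique Riesz isomorphism over E. *)
Record universal_completion {R : realType} (E Eu : rieszType R)
    (iota : {linear E -> Eu}) : Prop := UniversalCompletion {
  uc_dedekind : dedekind_complete Eu;
  uc_lateral : laterally_complete Eu;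
  uc_inj : injective iota;
  uc_join : forall x y, iota (Order.join x y) = Order.join (iota x) (iota y);
  uc_meet : forall x y, iota (Order.meet x y) = Order.meet (iota x) (iota y);
  uc_dense : forall u : Eu, 0 < u -> exists x : E, 0 < x /\ iota x <= u
}.

(* A net 0 <= x_i in E increasing to z in Eu, with (F x_i) order bounded in Eu. *)
Definition L1_net {R : realType} {E Eu : rieszType R}
    (iota : {linear E -> Eu}) (F : {linear E -> E}) {I : Type}
    (r : I -> I -> Prop) (x : I -> E) (z : Eu) : Prop :=
  [/\ directed r, forall i, 0 <= x i, net_increases_to r (iota \o x) z &
      order_bounded (range (iota \o F \o x))].

Definition L1_pos {R : realType} {E Eu : rieszType R}
    (iota : {linear E -> Eu}) (F : {linear E -> E}) : set Eu :=
  [set z | 0 <= z /\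
    exists (I : Type) (r : I -> I -> Prop) (x : I -> E), L1_net iota F r x z].

Definition L1 {R : realType} {E Eu : rieszType R}
    (iota : {linear E -> Eu}) (F : {linear E -> E}) : set Eu :=
  [set z | L1_pos iota F (vpos z) /\ L1_pos iota F (vneg z)].

(* The supremum w exists and is the same for every such net, so that xget merely
   names it. *)
Definition Fext_pos {R : realType} {E Eu : rieszType R}
    (iota : {linear E -> Eu}) (F : {linear E -> E}) (z : Eu) : Eu :=
  xget 0 [set w | exists (I : Type) (r : I -> I -> Prop) (x : I -> E),
    L1_net iota F r x z /\ supremums (range (iota \o F \o x)) w].

(* The extension of F to L1; its values outside L1 are irrelevant. *)
Definition Fext {R : realType} {E Eu : rieszType R}
    (iota : {linear E -> Eu}) (F : {linear E -> E}) (z : Eu) : Eu :=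
  Fext_pos iota F (vpos z) - Fext_pos iota F (vneg z).

Definition RF {R : realType} {E Eu : rieszType R}
    (iota : {linear E -> Eu}) (F : {linear E -> E}) : set Eu :=
  Fext iota F @` L1 iota F.

Definition Linfty {R : realType} {E Eu : rieszType R}
    (iota : {linear E -> Eu}) (F : {linear E -> E}) : set Eu :=
  [set f | exists u, RF iota F u /\ vabs f <= u].

(* infimum and supremum return the default 0 when the bound does not exist;
   cond_sup_infimums and cond_inf_supremums below show that on Linfty it does. *)
Definition cond_sup {R : realType} {E Eu : rieszType R}
    (iota : {linear E -> Eu}) (F : {linear E -> E}) (f : Eu) : Eu :=
  infimum 0 [set g | RF iota F g /\ f <= g].

Definition cond_inf {R : realType} {E Eu : rieszType R}
    (iota : {linear E -> Eu}) (F : {linear E -> E}) (f : Eu) : Eu :=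
  supremum 0 [set g | RF iota F g /\ g <= f].

Lemma riesz_lerN {R : realType} {E : rieszType R} (x y : E) :
  x <= y -> - y <= - x.
Proof. by move/(@riesz_lerD2r _ _ _ _ (- x - y)); rewrite addrA subrr sub0r addrCA subrr addr0. Qed.

Lemma dedekind_complete_inf {R : realType} {E : rieszType R} (A : set E) :
  dedekind_complete E -> has_inf A -> infimums A !=set0.
Proof.
move=> cE [A0 lA]; have [|s [us ls]] := cE (lbound A).
  by split=> //; have [a Aa] := A0; exists a => y; apply.
by exists s; split=> // a Aa; apply: ls => y; apply.
Qed.

Lemma RF_opp {R : realType} {E Eu : rieszType R} (iota : {linear E -> Eu})
  (F : {linear E -> E}) (g : Eu) : RF iota F g -> RF iota F (- g).
Proof.
have nN (z : Eu) : vneg (- z) = vpos z by rewrite /vneg opprK.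
by case=> z [z1 z2] <-; exists (- z); rewrite /L1 /Fext /= ?nN ?opprB.
Qed.

Lemma cond_sup_infimums {R : realType} {E Eu : rieszType R}
    (iota : {linear E -> Eu}) (F : {linear E -> E}) (f : Eu) :
  dedekind_complete Eu -> Linfty iota F f ->
  infimums [set g | RF iota F g /\ f <= g] (cond_sup iota F f).
Proof.
move=> cE [u [Ru fu]]; set A := [set _ | _].
have A0 : A !=set0 by exists u; split=> //; apply: le_trans fu; apply: leUl.
have [s As] : infimums A !=set0.
  by apply: dedekind_complete_inf => //; split=> //; exists f => g [].
rewrite /cond_sup /infimum ifF; first exact: (xgetI _ As).
by apply/negbTE/set0P.
Qed.

Lemma cond_inf_supremums {R : realType} {E Eu : rieszType R}
    (iota : {linear E -> Eu}) (F : {linear E -> E}) (f : Eu) :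
  dedekind_complete Eu -> Linfty iota F f ->
  supremums [set g | RF iota F g /\ g <= f] (cond_inf iota F f).
Proof.
move=> cE [u [Ru fu]]; set A := [set _ | _].
have A0 : A !=set0.
  exists (- u); split; first exact: RF_opp.
  by rewrite -[f]opprK; apply/riesz_lerN/(le_trans _ fu)/leUr.
have [s As] : supremums A !=set0 by apply: cE; split=> //; exists f => g [].
rewrite /cond_inf /supremum ifF; first exact: (xgetI _ As).
by apply/negbTE/set0P.
Qed.

(* Main.v *)
(* An element of [Eu] is in the range of the extended conditional expectation iff it
   is a difference of two elements of the cone of suprema in [Eu] of positive elements
   of the range of [F]: order continuity of [F] makes the extension the identity on
   this cone.  The cone is stable under suprema and under [(w, w') |-> (w - w')^+], so
   that, with [a0 - inf A = sup {(a0 - a)^+ | a in A}], the range contains the infima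
   existing in [Eu] of its nonempty subsets; hence it contains conditional suprema.
   The rest is formal, using [m f = - M (- f)]. *)
Require Import Defs.
From HB Require Import structures.
From mathcomp Require Import all_boot all_order all_algebra.
From mathcomp Require Import boolp classical_sets reals.
Import Order.TTheory GRing.Theory Num.Theory.
Local Open Scope classical_set_scope.
Local Open Scope ring_scope.

(** * Order arithmetic and lattice identities in Riesz spaces *)

Section RieszTheory.
Set Implicit Arguments.
Unset Strict Implicit.
Context {R : realType} {E : rieszType R}.
Implicit Types (x y z : E) (a : R).

Lemma riesz_lerD2rE z x y : (x + z <= y + z) = (x <= y).
Proof.
apply/idP/idP => [/(@riesz_lerD2r _ _ _ _ (- z))|]; last exact: riesz_lerD2r.
by rewrite !addrK.
Qed.

Lemma riesz_lerBlDr x y z : (x - y <= z) = (x <= z + y).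
Proof. by rewrite -[RHS](riesz_lerD2rE (- y)) addrK. Qed.

Lemma riesz_lerBrDr x y z : (x <= y - z) = (x + z <= y).
Proof. by rewrite -[LHS](riesz_lerD2rE z) subrK. Qed.

Lemma riesz_subr_ge0 x y : (0 <= x - y) = (y <= x).
Proof. by rewrite riesz_lerBrDr add0r. Qed.

Lemma riesz_subr_gt0 x y : (0 < x - y) = (y < x).
Proof. by rewrite !lt_def riesz_subr_ge0 subr_eq0. Qed.

Lemma riesz_lerD x y x' y' : x <= y -> x' <= y' -> x + x' <= y + y'.
Proof.
move=> xy xy'; apply: (@le_trans _ _ (y + x')); first exact: riesz_lerD2r.
by rewrite ![y + _]addrC riesz_lerD2rE.
Qed.

Lemma riesz_addr_ge0 x y : 0 <= x -> 0 <= y -> 0 <= x + y.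
Proof. by move=> x0 y0; rewrite -[0]addr0 riesz_lerD. Qed.

Lemma riesz_lerN2 x y : (- x <= - y) = (y <= x).
Proof. by apply/idP/idP => /riesz_lerN; rewrite ?opprK. Qed.

Lemma riesz_lerZ a x y : 0 <= a -> x <= y -> a *: x <= a *: y.
Proof.
by move=> a0 xy; rewrite -riesz_subr_ge0 -scalerBr riesz_scaler_ge0 // riesz_subr_ge0.
Qed.

Lemma riesz_lerZl a x y : 0 < a -> (a *: x <= y) = (x <= a^-1 *: y).
Proof.
move=> a0; have an0 : a != 0 by rewrite gt_eqF.
have ai0 : 0 <= a^-1 by rewrite invr_ge0 ltW.
apply/idP/idP => [/(riesz_lerZ ai0)|/(riesz_lerZ (ltW a0))].
  by rewrite scalerA mulVf // scale1r.
by rewrite scalerA divff // scale1r.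
Qed.

Lemma vpos_ge0 x : 0 <= vpos x. Proof. exact: leUr. Qed.
Lemma le_vpos x : x <= vpos x. Proof. exact: leUl. Qed.

Lemma vpos_le x y : (vpos x <= y) = (x <= y) && (0 <= y).
Proof. exact: leUx. Qed.

Lemma vnegE x : vneg x = vpos x - x.
Proof.
apply/le_anti; rewrite leUx riesz_subr_ge0 le_vpos.
rewrite -[X in X <= _]add0r riesz_lerD ?vpos_ge0 //=.
by rewrite riesz_lerBlDr vpos_le -riesz_lerBlDr addrN leUr -riesz_lerBlDr add0r leUl.
Qed.

Lemma vposBneg x : vpos x - vneg x = x.
Proof. by rewrite vnegE opprB addrC subrK. Qed.

Lemma vpos_meet x y : vpos (x - y) = x - Order.meet x y.
Proof.
apply/le_anti; rewrite vpos_le riesz_subr_ge0 leIl andbT.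
have -> : x - y <= x - Order.meet x y by rewrite riesz_lerD // riesz_lerN2 leIr.
rewrite riesz_lerBlDr addrC -riesz_lerBlDr lexI !riesz_lerBlDr.
rewrite -[X in X <= _]addr0 riesz_lerD ?vpos_ge0 //=.
by rewrite addrC -riesz_lerBlDr le_vpos.
Qed.

Lemma vabs_le x y : (vabs x <= y) = (x <= y) && (- x <= y).
Proof. exact: leUx. Qed.

Lemma vabsN x : vabs (- x) = vabs x.
Proof. by rewrite /vabs opprK joinC. Qed.

Lemma le_vabs x : x <= vabs x. Proof. exact: leUl. Qed.

Lemma leN_vabs x : - x <= vabs x. Proof. exact: leUr. Qed.

Lemma vabsD x y : vabs (x + y) <= vabs x + vabs y.
Proof. by rewrite vabs_le opprD !riesz_lerD ?le_vabs ?leN_vabs. Qed.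

Lemma vabs_le_posDneg x : vabs x <= vpos x + vneg x.
Proof.
have vn0 : 0 <= vneg x by exact: leUr.
rewrite vabs_le -[X in X <= _]addr0 riesz_lerD ?le_vpos //=.
by rewrite -[X in X <= _]add0r riesz_lerD ?vpos_ge0 //; apply: leUl.
Qed.

Lemma vabsZ_le a x : 0 <= a -> vabs (a *: x) <= a *: vabs x.
Proof. by move=> a0; rewrite vabs_le -scalerN !riesz_lerZ ?le_vabs ?leN_vabs. Qed.


(** The nontrivial half of infinite distributivity. For [u] in [A],
    [u = u ∧ x + (u - x)^+ <= y + (z - x)^+]; passing to the supremum gives [z <= y + (z - x)^+],
    and [(z - x)^+ = z - z ∧ x]. *)
Lemma meet_supremums (A : set E) x y z :
  supremums A z -> (forall u, A u -> Order.meet u x <= y) -> Order.meet z x <= y.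
Proof.
move=> [ubz lez] hy; have zy : z <= y + vpos (z - x).
  apply: lez => u Au; have uz : u <= z by exact: ubz.
  rewrite -[u](subrK (Order.meet u x)) addrC riesz_lerD ?hy // -vpos_meet.
  by rewrite vpos_le vpos_ge0 (le_trans _ (le_vpos _)) ?riesz_lerD2rE.
by rewrite -(riesz_lerD2rE (z - Order.meet z x)) addrC subrK -vpos_meet.
Qed.

End RieszTheory.

Section Range.
Set Implicit Arguments.
Unset Strict Implicit.
Context {R : realType} {E Eu : rieszType R} {e : E}.
Context {F : {linear E -> E}} {iota : {linear E -> Eu}}.
Hypothesis hE : conditional_riesz_triple e F.
Hypothesis hEu : universal_completion iota.

Let hF : conditional_expectation e F := crt_condexp hE.

(** * The embedding into the universal completion, and order continuity of [F] *)

Lemma embed_le x y : (iota x <= iota y) = (x <= y).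
Proof.
by rewrite !leEjoin -(inj_eq (uc_inj hEu)) (uc_join hEu).
Qed.

Lemma embed_ge0 x : (0 <= iota x) = (0 <= x).
Proof. by rewrite -[0 in LHS](linear0 iota) embed_le. Qed.

(** Order density makes [iota] preserve suprema: otherwise some [x > 0] in [E] has [iota x] below
    [(iota z - t)^+ = iota z - iota z ∧ t], and then [z - x] would be a smaller upper bound of
    [A]. *)
Lemma embed_supremums (A : set E) z (t : Eu) :
  supremums A z -> (forall x, A x -> iota x <= t) -> iota z <= t.
Proof.
move=> [ubz lez] At; apply: contrapT => nzt.
have : 0 < vpos (iota z - t).
  rewrite lt_def vpos_ge0 andbT; apply/eqP => z0; apply: nzt.
  by rewrite -[t]add0r -riesz_lerBlDr -z0 le_vpos.
move=> /(uc_dense hEu)[x [x0]].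
rewrite vpos_meet riesz_lerBrDr => xz.
suff : z <= z - x.
  by rewrite riesz_lerBrDr addrC -[X in _ <= X]add0r riesz_lerD2rE
    => /le_lt_trans/(_ x0); rewrite ltxx.
apply: lez => a Aa; rewrite riesz_lerBrDr -embed_le linearD addrC.
apply: le_trans xz; rewrite riesz_lerD // lexI At // andbT embed_le.
exact: ubz.
Qed.

Lemma condexp_le x y : x <= y -> F x <= F y.
Proof.
rewrite le_eqVlt => /predU1P[->//|]; rewrite -riesz_subr_gt0.
by move=> /(ce_strictly_positive hF)/ltW; rewrite linearB riesz_subr_ge0.
Qed.

Lemma condexp_range p : range F p -> F p = p.
Proof. by case=> x _ <-; exact: ce_projection hF _. Qed.

Lemma condexp_net_le {I : Type} (r : I -> I -> Prop) (x : I -> E) z (t : Eu) :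
  directed r -> net_increases_to r x z ->
  (forall i, iota (F (x i)) <= t) -> iota (F z) <= t.
Proof.
move=> dr [incx [ubz lez]] Ft.
have xz i : x i <= z by apply: ubz; exists i.
(* The net [z - x i] decreases to 0 and dominates [|x i - z|], so [x] order converges to [z]. *)
have [|y [[_ [_ lby]] Fy]] := @ce_order_continuous _ _ _ _ hF I r x z dr.
  exists (fun i => z - x i); split; first split.
  - by move=> i j /incx xij; rewrite addrC [X in _ <= X]addrC riesz_lerD2rE riesz_lerN2.
  - split=> [_ [i _ <-]|u ubu]; first by rewrite riesz_subr_ge0.
    suff : z <= z - u by rewrite riesz_lerBrDr addrC -riesz_lerBrDr subrr.
    apply: lez => _ [i _ <-]; rewrite riesz_lerBrDr addrC -riesz_lerBrDr.
    by apply: ubu; exists i.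
  - move=> i; rewrite vabs_le opprB lexx andbT.
    have zx0 : 0 <= z - x i by rewrite riesz_subr_ge0.
    by apply: le_trans zx0; rewrite riesz_lerBlDr add0r.
apply: (@embed_supremums (range (F \o x))); last by move=> _ [i _ <-]; exact: Ft.
split=> [_ [i _ <-]|u ubu]; first exact: condexp_le.
(* [F z - u <= F z - F (x i) <= y i] for every [i], and [y] has infimum 0. *)
rewrite -[u]add0r -riesz_lerBlDr; apply: lby => _ [i _ <-].
apply: le_trans (Fy i); apply: le_trans (leN_vabs _); rewrite opprB /=.
by rewrite riesz_lerD // riesz_lerN2; apply: ubu; exists i.
Qed.

(* Suprema taken in [E] and in the range agree: if [s] is the former and [t] the
   latter, then [s <= t] and [F t = t <= F s], hence [F (t - s) <= 0]. *)
Lemma range_supremums (B : set E) s :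
  B `<=` range F -> B !=set0 -> supremums B s -> range F s.
Proof.
move=> BF B0 [ubs les].
have BFs : ubound B (F s).
  by move=> b Bb; rewrite -(condexp_range (BF _ Bb)) condexp_le // ubs.
have [|t [Rt ubt let_]] := ce_range_complete hF BF B0.
  by exists (F s); split=> //; exists s.
have : s <= t by exact: les.
rewrite le_eqVlt => /predU1P[->//|]; rewrite -riesz_subr_gt0.
move=> /(ce_strictly_positive hF); rewrite linearB (condexp_range Rt).
move=> /lt_le_trans h; have /h : t - F s <= 0.
  by rewrite riesz_lerBlDr add0r let_ //; exists s.
by rewrite ltxx.
Qed.

(** * The cone of suprema of positive elements of the range of [F] *)

Definition range_below (w : Eu) : set E :=
  [set p | [/\ range F p, 0 <= p & iota p <= w]].

(* The positive cone of the range of the extension, by [RF_coneB]. *)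
Definition range_cone (w : Eu) : Prop :=
  0 <= w /\ supremums (iota @` range_below w) w.

Lemma range0 : range F 0.
Proof. by case: (ce_range_subspace hF). Qed.

Lemma rangeD p q : range F p -> range F q -> range F (p + q).
Proof. by case: (ce_range_subspace hF) => _ + _ _ _; apply. Qed.

Lemma rangeZ a p : range F p -> range F (a *: p).
Proof. by case: (ce_range_subspace hF) => _ _ + _ _; apply. Qed.

Lemma rangeB p q : range F p -> range F q -> range F (p - q).
Proof. by move=> Rp Rq; rewrite -scaleN1r; apply/rangeD/rangeZ. Qed.

Lemma range_below_directed w :
  0 <= w -> directed (fun p q : {p | range_below w p} => sval p <= sval q).
Proof.
move=> w0; split=> [|p|p q s|[p [Rp p0 pw]] [q [Rq q0 qw]]] //=.
- by exists; exists 0; split; rewrite ?linear0 //; exact: range0.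
- exact: le_trans.
- have pq : range_below w (Order.join p q).
    split; [|by rewrite (le_trans p0) ?leUl|by rewrite (uc_join hEu) leUx pw].
    by case: (ce_range_subspace hF) => _ _ _ + _; apply.
  by exists (exist _ _ pq); rewrite /= leUl leUr.
Qed.

(** Only upper bounds [t >= 0] have to be tested, since 0 belongs to [range_below w]. *)
Lemma range_coneP w : 0 <= w ->
  (forall t, 0 <= t -> (forall p, range_below w p -> iota p <= t) -> w <= t) ->
  range_cone w.
Proof.
move=> w0 h; split=> //; split=> [_ [p [_ _ pw] <-] //|t ubt].
have pt p : range_below w p -> iota p <= t by move=> pw; apply: ubt; exists p.
by apply: h => //; rewrite -(linear0 iota) pt //; split; rewrite ?linear0 //; exact: range0.
Qed.

Lemma range_cone_le w t : range_cone w ->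
  (forall p, range_below w p -> iota p <= t) -> w <= t.
Proof. by move=> [_ [_ lew]] h; apply: lew => _ [p wp <-]; exact: h. Qed.

Lemma range_cone0 : range_cone 0.
Proof. exact: range_coneP. Qed.

Lemma range_coneD w w' : range_cone w -> range_cone w' -> range_cone (w + w').
Proof.
move=> cw cw'; apply: range_coneP => [|t _ ht].
  by rewrite riesz_addr_ge0 ?(proj1 cw) ?(proj1 cw').
rewrite -riesz_lerBrDr; apply: (range_cone_le cw) => p [Rp p0 pw].
rewrite riesz_lerBrDr addrC -riesz_lerBrDr.
apply: (range_cone_le cw') => q [Rq q0 qw]; rewrite riesz_lerBrDr addrC -linearD.
by apply: ht; split; rewrite ?riesz_addr_ge0 ?linearD ?riesz_lerD //; exact: rangeD.
Qed.

Lemma range_coneZ a w : 0 <= a -> range_cone w -> range_cone (a *: w).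
Proof.
rewrite le_eqVlt => /predU1P[<- _|a0 cw]; first by rewrite scale0r; exact: range_cone0.
apply: range_coneP => [|t _ ht].
  by rewrite riesz_scaler_ge0 ?(proj1 cw) // ltW.
rewrite riesz_lerZl //; apply: (range_cone_le cw) => p [Rp p0 pw].
rewrite -riesz_lerZl // -linearZ /=; apply: ht; split; first exact: rangeZ.
- by rewrite riesz_scaler_ge0 // ltW.
- by rewrite linearZ /= riesz_lerZ // ltW.
Qed.

Lemma range_cone_supremums (D : set Eu) s :
  D `<=` range_cone -> D !=set0 -> supremums D s -> range_cone s.
Proof.
move=> Dc [d0 Dd0] [ubs les].
apply: range_coneP => [|t _ ht]; first exact: le_trans (proj1 (Dc _ Dd0)) (ubs _ Dd0).
apply: les => d Dd; apply: (range_cone_le (Dc _ Dd)) => p [Rp p0 pd].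
by apply: ht; split=> //; apply: le_trans pd (ubs _ Dd).
Qed.

(** Each range element [p] below [w] is split as [s + (p - s)], where [s] is its part below [w'].
    Since [p - s] is a range element below [(w - w')^+], [iota p <= t + iota s <= t + w']. *)
Lemma range_cone_vposB w w' :
  range_cone w -> range_cone w' -> range_cone (vpos (w - w')).
Proof.
move=> cw cw'; apply: range_coneP => [|t t0 ht]; first exact: vpos_ge0.
rewrite vpos_le t0 andbT riesz_lerBlDr.
apply: (range_cone_le cw) => p [Rp p0 pw].
(* [iota s] is the meet of [iota p] and [w'], so [iota (p - s) = vpos (iota p - w')]. *)
pose B : set E := [set q | range_below w' q /\ q <= p].
have B0 : B 0.
  by do !split; rewrite ?linear0 ?(proj1 cw') //; exact: range0.
have [s Bs] : supremums B !=set0.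
  by apply: (crt_complete hE); split; [exists 0|exists p => q []].
have Rs : range F s.
  by apply: (range_supremums _ _ Bs); [move=> q [[]]|exists 0].
have sp : s <= p by apply: (proj2 Bs) => q [].
have sw' : iota s <= w' by apply: (embed_supremums Bs) => q [[]].
suff h : iota (p - s) <= t.
  by move: h; rewrite linearB riesz_lerBlDr => /le_trans; apply; rewrite riesz_lerD.
apply: ht; split; [exact: rangeB|by rewrite riesz_subr_ge0|].
(* By distributivity it is enough to meet [p] with each range element [q] below [w'], and [q ∧ p]
   belongs to [B]. *)
have mps : Order.meet w' (iota p) <= iota s.
  apply: (meet_supremums (proj2 cw')) => _ [q [Rq q0 qw'] <-].
  rewrite -(uc_meet hEu) embed_le; apply: (proj1 Bs).
  do !split; rewrite ?leIr ?lexI ?q0 //.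
    by case: (ce_range_subspace hF) => _ _ _ _; apply.
  by apply: le_trans qw'; rewrite embed_le leIl.
rewrite linearB; apply: (@le_trans _ _ (vpos (iota p - w'))).
  by rewrite vpos_meet riesz_lerD // riesz_lerN2 meetC.
by rewrite vpos_le vpos_ge0 andbT (le_trans _ (le_vpos _)) // riesz_lerD.
Qed.

(** * The nets that define the extension, and its values on the cone *)

Lemma L1_net_sup_cone {I : Type} (r : I -> I -> Prop) (x : I -> E) z v :
  L1_net iota F r x z -> supremums (range (iota \o F \o x)) v -> range_cone v.
Proof.
case=> [[[i0] _ _ _] x0 _ _] [ubv lev].
have Fx0 i : 0 <= F (x i) by rewrite -(linear0 F) condexp_le.
apply: range_coneP => [|t t0 ht].
  by apply: (@le_trans _ _ (iota (F (x i0)))); [rewrite embed_ge0|apply: ubv; exists i0].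
(* Each [F (x i)] is itself a positive range element below [v]. *)
apply: lev => _ [i _ <-]; apply: ht; split=> //=; first by exists (x i).
by apply: ubv; exists i.
Qed.

Lemma net_meet {V : rieszType R} {I : Type} (r : I -> I -> Prop) (x : I -> V) z p :
  net_increases_to r x z -> p <= z ->
  net_increases_to r (fun i => Order.meet (x i) p) p.
Proof.
move=> [incx supz] pz; split=> [i j rij|].
  by rewrite lexI leIr andbT (le_trans (leIl _ _)) // incx.
split=> [_ [i _ <-]|t ubt]; first exact: leIr.
rewrite -(meet_r pz); apply: (meet_supremums supz) => _ [i _ <-].
by apply: ubt; exists i.
Qed.

Lemma net_embed {I : Type} (r : I -> I -> Prop) (x : I -> E) z :
  net_increases_to r (iota \o x) (iota z) -> net_increases_to r x z.
Proof.
move=> [incx [ubz lez]]; split=> [i j /incx|]; first by rewrite /= embed_le.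
split=> [_ [i _ <-]|t ubt]; first by rewrite -embed_le; apply: ubz; exists i.
by rewrite -embed_le; apply: lez => _ [i _ <-]; rewrite /= embed_le; apply: ubt; exists i.
Qed.

(** Order continuity of [F] is available in [E] only, whereas [z] lives in [Eu]. Truncating the net
    at [p] makes it increase to [p], inside [E]. *)
Lemma L1_net_meet_le {I : Type} (r : I -> I -> Prop) (x : I -> E) (z t : Eu) p :
  directed r -> net_increases_to r (iota \o x) z -> iota p <= z ->
  (forall i, iota (F (Order.meet (x i) p)) <= t) -> iota (F p) <= t.
Proof.
move=> dr xz pz; apply: (@condexp_net_le I r) => //; apply: net_embed.
have := net_meet xz pz; congr net_increases_to.
by apply/funext => i /=; rewrite (uc_meet hEu).
Qed.

Lemma range_below_net w : range_cone w ->
  net_increases_to (fun p q : {p | range_below w p} => sval p <= sval q)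
    (iota \o sval) w.
Proof.
move=> cw; split=> [p q|]; first by rewrite /= embed_le.
split=> [_ [[p [Rp p0 pw]] _ <-] //|t ubt].
by apply: (range_cone_le cw) => p wp; apply: ubt; exists (exist _ p wp).
Qed.

Lemma range_below_L1_net w : range_cone w ->
  L1_net iota F (fun p q : {p | range_below w p} => sval p <= sval q) sval w.
Proof.
move=> cw; split; first exact: range_below_directed (proj1 cw).
- by case=> p [].
- exact: range_below_net.
- exists 0, w => _ [[p [Rp p0 pw]] _ <-] /=.
  by rewrite condexp_range // embed_ge0 p0.
Qed.

(* Both inequalities meet the given net with the canonical net of elements of the
   range of [F] below [w], and use the order continuity of [F]. *)
Lemma L1_net_sup_eq {I : Type} (r : I -> I -> Prop) (x : I -> E) w v :
  range_cone w -> L1_net iota F r x w -> supremums (range (iota \o F \o x)) v ->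
  v = w.
Proof.
move=> cw [dr x0 xw _] [ubv lev]; apply/le_anti/andP; split.
  apply: lev => _ [i _ <-] /=.
  have xiw : iota (x i) <= w by apply: (proj1 (proj2 xw)); exists i.
  (* The canonical net is truncated at [x i]: [F (p ∧ x i) <= F p = p], which lies below [w]. *)
  apply: (L1_net_meet_le (range_below_directed (proj1 cw)) (range_below_net cw) xiw).
  case=> p [Rp p0 pw] /=; apply: le_trans pw.
  by rewrite embed_le -[X in _ <= X](condexp_range Rp) condexp_le // leIl.
(* Conversely the given net is truncated at [p = F p]. *)
apply: (range_cone_le cw) => p [Rp p0 pw]; rewrite -(condexp_range Rp).
apply: (L1_net_meet_le dr xw pw) => i; apply: (@le_trans _ _ (iota (F (x i)))).
  by rewrite embed_le condexp_le // leIl.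
by apply: ubv; exists i.
Qed.

Lemma Fext_pos_cone z : L1_pos iota F z -> range_cone (Fext_pos iota F z).
Proof.
move=> [_ [I [r [x Lx]]]].
have [v sv] : supremums (range (iota \o F \o x)) !=set0.
  case: Lx => [[[i0] _ _ _] _ _ [a [b ab]]]; apply: (uc_dedekind hEu).
  by split; [exists (iota (F (x i0))), i0|exists b => u /ab/andP[]].
(* The witness [v] excludes the default value of [xget]; whichever supremum is picked, it lies in
   the cone. *)
rewrite /Fext_pos; case: xgetP => [w _ [J [s [y [Ly sy]]]]|]; last first.
  by move=> /(_ v)[]; exists I, r, x.
exact: L1_net_sup_cone Ly sy.
Qed.

(** The canonical net of range elements below [w] is fixed by [F], so [w] is a possible value;
    [L1_net_sup_eq] makes it the only one. *)
Lemma Fext_pos_id w : range_cone w -> Fext_pos iota F w = w.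
Proof.
move=> cw; have Lw := range_below_L1_net cw.
rewrite /Fext_pos; case: xgetP => [v _ [J [s [y [Ly sy]]]]|].
  exact: L1_net_sup_eq cw Ly sy.
move=> /(_ w)[]; eexists _, _, _; split; first exact: Lw.
rewrite (_ : _ \o _ = iota \o sval); first exact: (proj2 (range_below_net cw)).
by apply/funext => -[p [Rp p0 pw]] /=; rewrite condexp_range.
Qed.

Lemma cone_L1_pos w : range_cone w -> L1_pos iota F w.
Proof.
move=> cw; split; first exact: (proj1 cw).
by eexists _, _, _; exact: range_below_L1_net.
Qed.

(** * The range of the extension *)

Lemma RF_coneB f :
  RF iota F f <-> exists w w', [/\ range_cone w, range_cone w' & f = w - w'].
Proof.
split=> [[z [zp zn] <-]|[w [w' [cw cw' ->]]]].
  by exists (Fext_pos iota F (vpos z)), (Fext_pos iota F (vneg z)); split=> //;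
    exact: Fext_pos_cone.
have cp := range_cone_vposB cw cw'.
have cn : range_cone (vneg (w - w')).
  by rewrite /vneg opprB; exact: range_cone_vposB.
(* The element is its own preimage: its positive and negative parts lie in the cone, where
   [Fext_pos] is the identity. *)
exists (w - w'); first by split; exact: cone_L1_pos.
by rewrite /Fext !Fext_pos_id // vposBneg.
Qed.

Lemma RF_vpos f : RF iota F f -> range_cone (vpos f).
Proof. by move=> /RF_coneB[w [w' [cw cw' ->]]]; exact: range_cone_vposB. Qed.

Lemma cone_RF w : range_cone w -> RF iota F w.
Proof. by move=> cw; apply/RF_coneB; exists w, 0; rewrite subr0; split=> //; exact: range_cone0. Qed.

Lemma RF0 : RF iota F 0.
Proof. exact/cone_RF/range_cone0. Qed.

Lemma RFD f g : RF iota F f -> RF iota F g -> RF iota F (f + g).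
Proof.
move=> /RF_coneB[w [w' [cw cw' ->]]] /RF_coneB[v [v' [cv cv' ->]]].
by apply/RF_coneB; exists (w + v), (w' + v'); rewrite opprD addrACA; split=> //;
  exact: range_coneD.
Qed.

Lemma RFB f g : RF iota F f -> RF iota F g -> RF iota F (f - g).
Proof. by move=> Rf /RF_opp; exact: RFD. Qed.

Lemma RFZ a f : 0 <= a -> RF iota F f -> RF iota F (a *: f).
Proof.
move=> a0 /RF_coneB[w [w' [cw cw' ->]]]; apply/RF_coneB.
by exists (a *: w), (a *: w'); rewrite scalerBr; split=> //; exact: range_coneZ.
Qed.

Lemma RF_infimums (A : set Eu) s :
  A `<=` RF iota F -> A !=set0 -> infimums A s -> RF iota F s.
Proof.
move=> AR [a0 Aa0] [lbs les]; rewrite -[s](subKr a0).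
apply/RFB/cone_RF; first exact: AR.
apply: (@range_cone_supremums ((fun a => vpos (a0 - a)) @` A)).
- by move=> _ [a Aa <-]; apply/RF_vpos/RFB; exact: AR.
- by exists (vpos (a0 - a0)), a0.
(* Taking positive parts leaves the supremum [a0 - s] unchanged, because [a0 - s >= 0]. *)
split=> [_ [a Aa <-]|t ubt].
  by rewrite vpos_le riesz_subr_ge0 lbs // andbT riesz_lerD // riesz_lerN2 lbs.
rewrite riesz_lerBlDr addrC -riesz_lerBlDr; apply: les => a Aa.
rewrite riesz_lerBlDr addrC -riesz_lerBlDr; apply: le_trans (le_vpos _) _.
by apply: ubt; exists a.
Qed.

(** * The ideal [Linfty] and the conditional supremum and infimum *)

Lemma Linfty_RF f : RF iota F f -> Linfty iota F f.
Proof.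
move=> Rf; exists (vpos f + vneg f); split; last exact: vabs_le_posDneg.
apply/cone_RF/range_coneD; first exact: RF_vpos.
exact/(@RF_vpos (- f))/RF_opp.
Qed.

Lemma LinftyN f : Linfty iota F f -> Linfty iota F (- f).
Proof. by move=> [u [Ru fu]]; exists u; rewrite vabsN. Qed.

Lemma LinftyD f g : Linfty iota F f -> Linfty iota F g -> Linfty iota F (f + g).
Proof.
move=> [u [Ru fu]] [v [Rv gv]]; exists (u + v); split; first exact: RFD.
by apply: le_trans (vabsD _ _) _; exact: riesz_lerD.
Qed.

Lemma LinftyZ a f : 0 <= a -> Linfty iota F f -> Linfty iota F (a *: f).
Proof.
move=> a0 [u [Ru fu]]; exists (a *: u); split; first exact: RFZ.
by apply: le_trans (vabsZ_le _ a0) _; exact: riesz_lerZ.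
Qed.

Lemma Linfty_vabs f : Linfty iota F f -> Linfty iota F (vabs f).
Proof.
move=> [u [Ru fu]]; exists u; split=> //; rewrite vabs_le fu /=.
apply: le_trans fu; apply: le_trans (le_vabs f).
by rewrite -[X in _ <= X]opprK riesz_lerN2 leN_vabs.
Qed.

(** The infimum defining [cond_sup] is attained, so it is the least element of [RF] above [f]; the
    later properties rest on this. *)
Lemma cond_sup_RF f : Linfty iota F f -> RF iota F (cond_sup iota F f).
Proof.
move=> Lf; apply: RF_infimums (cond_sup_infimums (uc_dedekind hEu) Lf).
  by move=> g [].
case: Lf => u [Ru fu]; exists u; split=> //; exact: le_trans (le_vabs f) fu.
Qed.

Lemma le_cond_sup f : Linfty iota F f -> f <= cond_sup iota F f.
Proof. by move=> /(cond_sup_infimums (uc_dedekind hEu))[_]; apply=> g []. Qed.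

Lemma cond_sup_le f g :
  Linfty iota F f -> RF iota F g -> f <= g -> cond_sup iota F f <= g.
Proof.
by move=> /(cond_sup_infimums (uc_dedekind hEu))[lbM _] Rg fg; exact: lbM.
Qed.

(** Negation preserves [RF] and swaps lower bounds of [f] with upper bounds of [- f]. *)
Lemma cond_infE f : Linfty iota F f -> cond_inf iota F f = - cond_sup iota F (- f).
Proof.
move=> Lf; have LNf := LinftyN Lf.
have [ubm lem] := cond_inf_supremums (uc_dedekind hEu) Lf.
apply/le_anti/andP; split.
  apply: lem => g [Rg gf]; rewrite -[g]opprK riesz_lerN2.
  by rewrite cond_sup_le ?riesz_lerN2 //; exact: RF_opp.
apply: ubm; split; first exact/RF_opp/cond_sup_RF.
by rewrite -[f in _ <= f]opprK riesz_lerN2 le_cond_sup.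
Qed.

Lemma cond_sup_id f : RF iota F f -> cond_sup iota F f = f.
Proof.
move=> Rf; have Lf := Linfty_RF Rf.
by apply/le_anti; rewrite cond_sup_le // le_cond_sup.
Qed.

Lemma cond_inf_id f : RF iota F f -> cond_inf iota F f = f.
Proof.
by move=> Rf; rewrite cond_infE ?cond_sup_id ?opprK //; [exact: RF_opp|exact: Linfty_RF].
Qed.

Lemma cond_sup_homo f g : Linfty iota F f -> Linfty iota F g ->
  f <= g -> cond_sup iota F f <= cond_sup iota F g.
Proof.
by move=> Lf Lg fg; rewrite cond_sup_le ?(le_trans fg) ?le_cond_sup //; exact: cond_sup_RF.
Qed.

Lemma cond_inf_homo f g : Linfty iota F f -> Linfty iota F g ->
  f <= g -> cond_inf iota F f <= cond_inf iota F g.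
Proof.
move=> Lf Lg fg; rewrite !cond_infE // riesz_lerN2.
by apply: cond_sup_homo; rewrite ?riesz_lerN2 //; exact: LinftyN.
Qed.

Lemma cond_supZ a f : 0 <= a -> Linfty iota F f ->
  cond_sup iota F (a *: f) = a *: cond_sup iota F f.
Proof.
rewrite le_eqVlt => /predU1P[<- _|a0 Lf].
  by rewrite !scale0r cond_sup_id //; exact: RF0.
have Laf : Linfty iota F (a *: f) by apply: LinftyZ => //; exact: ltW.
apply/le_anti/andP; split.
  rewrite cond_sup_le ?riesz_lerZ ?le_cond_sup ?ltW //.
  by apply/RFZ/cond_sup_RF => //; exact: ltW.
(* [a^-1 *: cond_sup (a *: f)] is an element of [RF] above [f]. *)
rewrite riesz_lerZl // cond_sup_le -?riesz_lerZl ?le_cond_sup //.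
by apply/RFZ/cond_sup_RF => //; rewrite invr_ge0 ltW.
Qed.

Lemma cond_supD_le f g : Linfty iota F f -> Linfty iota F g ->
  cond_sup iota F (f + g) <= cond_sup iota F f + cond_sup iota F g.
Proof.
move=> Lf Lg; apply: cond_sup_le; first exact: LinftyD.
  by apply: RFD; exact: cond_sup_RF.
by rewrite riesz_lerD ?le_cond_sup.
Qed.

(** One inequality is sub-additivity with [cond_sup g = g]; for the other, [cond_sup (f + g) - g] is
    an element of [RF] above [f]. *)
Lemma cond_supDr f g : Linfty iota F f -> RF iota F g ->
  cond_sup iota F (f + g) = g + cond_sup iota F f.
Proof.
move=> Lf Rg; have Lg := Linfty_RF Rg; have Lfg := LinftyD Lf Lg.
apply/le_anti/andP; split.
  by rewrite [X in _ <= X]addrC -{2}(cond_sup_id Rg) cond_supD_le.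
rewrite addrC -riesz_lerBrDr; apply: cond_sup_le => //.
  by apply: RFB => //; exact: cond_sup_RF.
by rewrite riesz_lerBrDr le_cond_sup.
Qed.

Lemma cond_infDr f g : Linfty iota F f -> RF iota F g ->
  cond_inf iota F (f + g) = g + cond_inf iota F f.
Proof.
move=> Lf Rg; rewrite !cond_infE //; last exact/LinftyD/Linfty_RF.
by rewrite opprD cond_supDr ?opprD ?opprK //; [exact: LinftyN|exact: RF_opp].
Qed.

(** Monotonicity and sub-additivity applied to [f <= |f - g| + g]. *)
Lemma cond_supB_le f g : Linfty iota F f -> Linfty iota F g ->
  cond_sup iota F f - cond_sup iota F g <= cond_sup iota F (vabs (f - g)).
Proof.
move=> Lf Lg; have Lfg := LinftyD Lf (LinftyN Lg); have Labs := Linfty_vabs Lfg.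
rewrite riesz_lerBlDr; apply: le_trans (cond_supD_le Labs Lg).
apply: cond_sup_homo => //; first exact: LinftyD.
by rewrite -riesz_lerBlDr le_vabs.
Qed.

Lemma cond_supB_vabs f g : Linfty iota F f -> Linfty iota F g ->
  vabs (cond_sup iota F f - cond_sup iota F g) <= cond_sup iota F (vabs (f - g)).
Proof.
move=> Lf Lg; rewrite vabs_le opprB cond_supB_le //=.
by rewrite -(vabsN (f - g)) opprB cond_supB_le.
Qed.

Lemma cond_infB_vabs f g : Linfty iota F f -> Linfty iota F g ->
  vabs (cond_inf iota F f - cond_inf iota F g) <= cond_sup iota F (vabs (f - g)).
Proof.
move=> Lf Lg; have := cond_supB_vabs (LinftyN Lf) (LinftyN Lg).
by rewrite -opprD vabsN !cond_infE // -opprD vabsN.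
Qed.

End Range.

Theorem proposition3 (R : realType) (E Eu : rieszType R) (e : E)
    (F : {linear E -> E}) (iota : {linear E -> Eu})
    (hE : conditional_riesz_triple e F)
    (hEu : universal_completion iota) :
  let M := cond_sup iota F in
  let m := cond_inf iota F in
  let Linf := Linfty iota F in
  let RgF := RF iota F in
  (* (i) *)
  ((forall f, Linf f -> RgF (M f) /\ RgF (m f)) /\
   (forall f, Linf f -> M (M f) = M f /\ m (m f) = m f) /\
   (forall f g, Linf f -> Linf g -> f <= g -> M f <= M g /\ m f <= m g)) /\
  (* (ii) *)
  ((forall (a : R) f, 0 <= a -> Linf f -> M (a *: f) = a *: M f) /\
   (forall f g, Linf f -> Linf g -> M (f + g) <= M f + M g) /\
   (forall f g, Linf f -> RgF g ->
      M (f + g) = g + M f /\ m (f + g) = g + m f)) /\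
  (* (iii) *)
  ((forall f g, Linf f -> Linf g ->
      vabs (M f - M g) <= M (vabs (f - g)) /\
      vabs (m f - m g) <= M (vabs (f - g))) /\
   (forall f, Linf f -> vabs (M f) <= M (vabs f))).
Proof.
move=> M m Linf RgF; split; [split; [|split]|split; [split; [|split]|split]].
- move=> f Lf; split; first exact: (cond_sup_RF hE hEu).
  rewrite /m (cond_infE hE hEu) //.
  exact/RF_opp/(cond_sup_RF hE hEu)/LinftyN.
(* Idempotence: both values lie in [RF], where both operators are the identity. *)
- move=> f Lf; have RM := cond_sup_RF hE hEu Lf.
  have Rm : RgF (m f).
    rewrite /m (cond_infE hE hEu) //.
    exact/RF_opp/(cond_sup_RF hE hEu)/LinftyN.
  by rewrite /M /m (cond_sup_id hE hEu) // (cond_inf_id hE hEu).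
- by move=> f g Lf Lg fg; split; [exact: (cond_sup_homo hE hEu)|exact: (cond_inf_homo hE hEu)].
- by move=> a f; exact: (cond_supZ hE hEu).
- by move=> f g; exact: (cond_supD_le hE hEu).
- by move=> f g Lf Rg; split; [exact: (cond_supDr hE hEu)|exact: (cond_infDr hE hEu)].
- by move=> f g Lf Lg; split; [exact: (cond_supB_vabs hE hEu)|exact: (cond_infB_vabs hE hEu)].
(* The case [g = 0] of the previous estimate, with [M 0 = 0]. *)
- move=> f Lf; have R0 := RF0 hE hEu; have L0 := Linfty_RF hE hEu R0.
  have := cond_supB_vabs hE hEu Lf L0.
  by rewrite (cond_sup_id hE hEu R0) !subr0.
Qed.
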